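(* Let $\mathbf{x}$ be a sequence over a finite alphabet that is not eventually periodic and is reversal-closed. For all $n\ge 1$, \[ \tfrac{1}{2} \rho_{\mathbf{x}}(n) \leq r_{\mathbf{x}}(n) < \tfrac{1}{2} \rho_{\mathbf{x}}(n) + \tfrac{8}{n}\, \rho_{\mathbf{x}}\!\left( n + \left\lfloor\tfrac{n}{4}\right\rfloor \right). \]
   Context: A factor of a sequence is a finite contiguous block. For $u=u(1)\cdots u(m)$, $u^R=u(m)\cdots u(1)$. $\mathbf{x}$ is reversal-closed if $w^R$ is a factor for every factor $w$; eventually periodic if $\mathbf{x}=uv^\omega$ with $v$ nonempty. $\rho_{\mathbf{x}}(n)$ is the number of distinct length-$n$ factors; $r_{\mathbf{x}}(n)$ the number of distinct length-$n$ factors up to $u\sim v\iff v\in\{u,u^R\}$. *)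

(* Defs.v *)
From mathcomp Require Import all_boot.
From mathcomp Require Import boolp.

Set Implicit Arguments.
Unset Strict Implicit.
Unset Printing Implicit Defensive.

Section Sequences.
Variable A : finType.
Implicit Types (x : nat -> A) (u v : seq A).

Definition factor x u : Prop :=
  exists i, u = mkseq (fun k => x (i + k)) (size u).

(* The infinite word u s: past the end of u, the default value of nth is
   the corresponding letter of s. *)
Definition catw u (s : nat -> A) : nat -> A :=
  fun k => nth (s (k - size u)) u k.

(* The infinite word (a v)^omega; the period a :: v is nonempty. *)
Definition omegaw (a : A) v : nat -> A :=
  fun k => nth a (a :: v) (k %% size (a :: v)).

Definition eventually_periodic x : Prop :=
  exists u a v, forall k, x k = catw u (omegaw a v) k.

Definition reversal_closed x : Prop :=
  forall w, factor x w -> factor x (rev w).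

Definition factors x n : {set n.-tuple A} :=
  [set u : n.-tuple A | `[< factor x u >]].

Definition rho x n : nat := #|factors x n|.

Definition rev_equiv n : rel (n.-tuple A) :=
  fun (u v : n.-tuple A) => v \in [:: u; [tuple of rev u]].

Definition refl_complexity x n : nat :=
  #|equivalence_partition (@rev_equiv n) (factors x n)|.

End Sequences.

(* Main.v *)
Require Import Defs.
From mathcomp Require Import all_boot all_order all_algebra.
From mathcomp Require Import zify lra.
From mathcomp Require boolp.

Set Implicit Arguments.
Unset Strict Implicit.
Unset Printing Implicit Defensive.

Import Order.TTheory GRing.Theory Num.Theory.

(* Classes under reversal have one element (palindromes) or two, so
   2 r(n) = rho(n) + pal(n), where pal(n) counts the palindromic factors, and
   it suffices to bound pal(n).  Put m = n / 4.  Reversal-closedness makes x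
   recurrent, and aperiodicity then gives every factor w of length n an
   occurrence t(w) >= m that is isolated: w does not occur again at
   t(w) + 1, ..., t(w) + m.  Send a pair (w, j), with w a palindrome and
   j <= m, to the factor of length n + m starting at t(w) - j.  Isolation
   forces pairs in a common fiber to have distinct w.  But among three
   palindromes of length n at offsets within m of each other two coincide:
   they generate a period p of the whole stretch such that all the offset
   differences are multiples of p / 2.  So fibers have at most two elements,
   and (m + 1) pal(n) <= 2 rho(n + m). *)

(** * Periods forced by overlapping palindromes *)

Section LocalPeriods.
Variable A : eqType.
Implicit Types (f : nat -> A) (d n p q t : nat).

Definition period_upto f p n := forall t, t + p < n -> f (t + p) = f t.

Definition pal_at f n t := forall k, k < n -> f (t + k) = f (t + (n - k.+1)).

Definition same_block f n s t := forall k, k < n -> f (s + k) = f (t + k).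

(** The reflections of the two palindromes have centres [d] apart, so their composition is a
    translation by [2 * d]. *)
Lemma two_palindromes_period f n t d :
    pal_at f n t -> pal_at f n (t + d) ->
  period_upto (fun k => f (t + k)) (2 * d) (n + d).
Proof.
move=> palt pald k k_lt.
have -> : t + (k + 2 * d) = t + d + (k + d) by lia.
rewrite pald; last by lia.
rewrite [RHS]palt; last by lia.
by congr f; lia.
Qed.

(** Move right by [q], then left by [p]; near the right end, move left first. The bound [p + q <= n]
    keeps one of the two routes inside. *)
Lemma period_uptoB f n p q :
    p <= q -> p + q <= n -> period_upto f p n -> period_upto f q n ->
  period_upto f (q - p) n.
Proof.
move=> le_pq le_n perp perq t t_lt.
have [tq | tq] := ltnP (t + q) n.
  rewrite -(perq t tq) -(perp (t + (q - p))); last by lia.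
  by congr f; lia.
rewrite -(subnK (_ : p <= t)); last by lia.
rewrite (perp (t - p)); last by lia.
by rewrite -(perq (t - p)); [congr f|]; lia.
Qed.

Lemma period_uptoM f n p q : p %| q -> period_upto f p n -> period_upto f q n.
Proof.
case/dvdnP=> c -> perp; elim: c => [|c IH] t t_lt; first by rewrite addn0.
rewrite mulSn addnCA addnC perp; last by lia.
by apply: IH; lia.
Qed.

(* The divisibility consequence of the Fine-Wilf theorem, taken in the form
   that the differences p <= q, q - p, ... of two short periods are periods. *)
Lemma minimal_period f n q :
    0 < q -> 2 * q <= n -> period_upto f q n ->
  exists p, [/\ 0 < p, p <= q, period_upto f p n &
    forall q', p + q' <= n -> period_upto f q' n -> p %| q'].
Proof.
move=> q_gt0 q_le perq.
pose P p := boolp.asbool (0 < p /\ period_upto f p n).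
have exP : exists p, P p by exists q; apply/boolp.asboolP.
case: (ex_minnP exP) => p /boolp.asboolP[p_gt0 perp] p_min.
exists p; split=> //; first by apply/p_min/boolp.asboolP.
elim/ltn_ind=> q' IH q'_le perq'.
have [-> | q'_gt0] := posnP q'; first exact: dvdn0.
have le_pq' : p <= q' by apply/p_min/boolp.asboolP.
have dvdB : p %| q' - p.
  by apply: IH; [lia | lia | exact: period_uptoB].
by rewrite -(subnK le_pq') dvdn_add.
Qed.

(** The least period [p] of the first block divides [2 * a] and [2 * (a + b)], hence [2 * b]. If it
    divides neither [a] nor [b], both are odd multiples of half of [p], so [p] divides [a + b]. *)
Lemma three_palindromes_from0 f n a b :
    0 < a -> 0 < b -> 4 * (a + b) <= n ->
    pal_at f n 0 -> pal_at f n a -> pal_at f n (a + b) ->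
  [\/ same_block f n 0 a, same_block f n 0 (a + b)
    | same_block f n a (a + b)].
Proof.
move=> a_gt0 b_gt0 n_ge pal0 pala palb.
have perA : period_upto f (2 * a) (n + a).
  by have := @two_palindromes_period f n 0 a pal0; apply.
have perB : period_upto f (2 * (a + b)) (n + (a + b)).
  by have := @two_palindromes_period f n 0 (a + b) pal0; apply.
have sub q l : period_upto f q (n + l) -> period_upto f q n.
  by move=> perq t t_lt; apply: perq; lia.
have [||p [p_gt0 p_le perp dvdp]] := minimal_period _ _ (sub _ _ perA);
  [lia | lia |].
have dvdA : p %| 2 * a by apply: dvdp (sub _ _ perA); lia.
have dvdB : p %| 2 * (a + b) by apply: dvdp (sub _ _ perB); lia.
(* Past the first block, shift both positions left by the period [2 * (a + b)] of the whole stretch;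
   they land in that block. *)
have perZ : period_upto f p (n + (a + b)).
  move=> t t_lt; have [tp | tp] := ltnP (t + p) n; first exact: perp.
  have le_t : 2 * (a + b) <= t by lia.
  rewrite -(subnK le_t) addnAC perB ?perB ?perp //; lia.
have blockD s d : p %| d -> s + d <= a + b -> same_block f n s (s + d).
  move=> dvd_d le_sd k k_lt.
  by rewrite addnAC (period_uptoM dvd_d perZ) //; lia.
have [pa | pa] := boolP (p %| a).
  by apply: Or31; exact: (blockD 0 a pa (leq_addr _ _)).
have [pb | pb] := boolP (p %| b); first by apply: Or33; exact: blockD.
apply: Or32; apply: (blockD 0 (a + b)); last exact: leqnn.
case/dvdnP: dvdA => u Du; case/dvdnP: dvdB => v Dv.
have odd_u : odd u.
  apply: contraR pa => even_u; apply/dvdnP; exists u./2.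
  by have := odd_double_half u; rewrite (negbTE even_u) -muln2; nia.
have odd_v : ~~ odd v.
  apply: contra pb => odd_v; apply/dvdnP; exists (v - u)./2.
  have := odd_double_half (v - u); have le_uv : u <= v by nia.
  rewrite oddB // odd_u odd_v -muln2 => ?; nia.
apply/dvdnP; exists v./2.
by have := odd_double_half v; rewrite (negbTE odd_v) -muln2; nia.
Qed.

Lemma three_palindromes f n i j k :
    i < j -> j < k -> 4 * (k - i) <= n ->
    pal_at f n i -> pal_at f n j -> pal_at f n k ->
  [\/ same_block f n i j, same_block f n i k | same_block f n j k].
Proof.
move=> lt_ij lt_jk n_ge pali palj palk; pose g t := f (i + t).
have palg d : pal_at f n (i + d) -> pal_at g n d.
  by move=> pald t t_lt; rewrite /g !addnA pald.
have blockg s d : same_block g n s d -> same_block f n (i + s) (i + d).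
  by move=> eq_sd t t_lt; have := eq_sd t t_lt; rewrite /g !addnA.
have Dj : i + (j - i) = j by lia.
have Dk : i + (j - i + (k - j)) = k by lia.
have [||||||/blockg|/blockg|/blockg] :=
    @three_palindromes_from0 g n (j - i) (k - j); rewrite ?addn0 ?Dj ?Dk.
- by rewrite subn_gt0.
- by rewrite subn_gt0.
- lia.
- by apply: palg; rewrite addn0.
- by apply: palg; rewrite Dj.
- by apply: palg; rewrite Dk.
- exact: Or31.
- exact: Or32.
- exact: Or33.
Qed.

End LocalPeriods.

(** * Windows, recurrence and isolated occurrences *)

Section Words.
Variable A : finType.
Implicit Types (x : nat -> A) (w : seq A).

Definition window x n t : n.-tuple A := [tuple of mkseq (fun k => x (t + k)) n].

Lemma windowP x n s t :
  window x n s = window x n t <-> same_block x n s t.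
Proof.
split=> [/(congr1 val)/= eqw k k_lt | eqx].
  by have := congr1 (nth (x 0) ^~ k) eqw; rewrite !nth_mkseq.
apply/val_inj/(@eq_from_nth _ (x 0)) => [|k]; rewrite !size_mkseq // => k_lt.
by rewrite !nth_mkseq //; apply: eqx.
Qed.

Lemma factorsP x n (u : n.-tuple A) :
  reflect (exists t, u = window x n t) (u \in factors x n).
Proof.
rewrite inE; apply: (iffP (boolp.asboolP _)) => -[t Du]; exists t.
  by apply: val_inj; rewrite /= {1}Du size_tuple.
by rewrite size_tuple Du.
Qed.

Lemma window_factor x n t : window x n t \in factors x n.
Proof. by apply/factorsP; exists t. Qed.

Lemma palindrome_window x n t :
  rev (window x n t) = window x n t :> seq A -> pal_at x n t.
Proof.
move=> /= eqw k k_lt; have := congr1 (nth (x 0) ^~ k) eqw.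
rewrite nth_rev size_mkseq // !nth_mkseq //; lia.
Qed.

Lemma eventually_period_eventually_periodic x N p :
    0 < p -> (forall k, N <= k -> x (k + p) = x k) -> eventually_periodic x.
Proof.
case: p => // p _ per.
exists (mkseq x N), (x N), (mkseq (fun k => x (N + k.+1)) p) => k.
rewrite /catw size_mkseq; have [lt_kN | le_Nk] := ltnP k N.
  by rewrite nth_mkseq.
rewrite nth_default ?size_mkseq // /omegaw /= size_mkseq.
have -> : x N :: mkseq (fun k => x (N + k.+1)) p
    = mkseq (fun k => x (N + k)) p.+1.
  by rewrite /mkseq /= addn0 -[1]/(1 + 0) iotaDl -map_comp.
rewrite nth_mkseq ?ltn_pmod //.
have perM c j : N <= j -> x (j + c * p.+1) = x j.
  elim: c => [|c IH] le_Nj; first by rewrite addn0.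
  by rewrite mulSn addnCA addnC per ?IH //; lia.
rewrite -[in LHS](subnKC le_Nk) {1}(divn_eq (k - N) p.+1) addnCA addnC perM //.
exact: leq_addr.
Qed.

Lemma reversal_closed_recurrent x n s N :
  reversal_closed x -> exists2 t, N <= t & window x n t = window x n s.
Proof.
move=> x_rev.
have flip m i : exists j, forall k, k < m -> x (j + k) = x (i + (m - k.+1)).
  have /x_rev[j Dj] : factor x (window x m i).
    by exists i; rewrite /= size_mkseq.
  exists j => k k_lt; have := congr1 (nth (x 0) ^~ k) Dj.
  rewrite size_rev /= size_mkseq nth_rev ?size_mkseq // !nth_mkseq //; lia.
(* Reversing a prefix of length N + s + n pushes the reversed block to the
   right of N; reversing a prefix that contains it pushes the block itself. *)
have [i Di] := flip (N + s + n) 0.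
have [j Dj] := flip (i + N + n + N) 0.
exists (j + N); first exact: leq_addl.
apply/windowP => k k_lt; rewrite -addnA Dj; last by lia.
have -> : 0 + (i + N + n + N - (N + k).+1) = i + (N + (n - k.+1)) by lia.
by rewrite Di; [congr x|]; lia.
Qed.

(* If every late occurrence of the block had another one at distance at most
   m, the first such distance d0 would be an eventual period: distances d <= m
   are periods of the block, and x (k + d0) = x (k + d0 - d) = x (k - d) = x k. *)
Lemma isolated_occurrence x n m s :
    ~ eventually_periodic x -> reversal_closed x -> 4 * m <= n ->
  exists t, [/\ m <= t, window x n t = window x n s
    & forall d, 0 < d <= m -> window x n (t + d) <> window x n t].
Proof.
move=> x_aper x_rev le_mn; apply: boolp.contrapT => no_t.
have next t : m <= t -> window x n t = window x n s ->
    exists2 d, 0 < d <= m & window x n (t + d) = window x n t.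
  move=> le_mt Dt; apply: boolp.contrapT => no_d; apply: no_t.
  by exists t; split=> // d d_m eqd; apply: no_d; exists d.
have [t0 le_mt0 Dt0] := reversal_closed_recurrent n s m x_rev.
have [d0 /andP[d0_gt0 d0_le] /windowP eqd0] := next t0 le_mt0 Dt0.
(* Invariant while jumping from one occurrence to the next: [d0] is a period from [t0] up to the end
   of the occurrence reached. *)
have run N : exists t, [/\ t0 + N <= t, window x n t = window x n s
    & forall k, t0 <= k -> k + d0 < t + n -> x (k + d0) = x k].
  elim: N => [|N [t [le_t Dt per]]].
    exists t0; split=> // [|k le_k lt_k]; first by rewrite addn0.
    have := eqd0 (k - t0); rewrite addnAC subnKC //; apply; lia.
  have [||d /andP[d_gt0 d_le] eqd] := next t; [lia | exact: Dt |].
  exists (t + d); split=> [||k le_k lt_k]; [lia | by rewrite eqd |].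
  have [lt_kt | le_tk] := ltnP (k + d0) (t + n); first exact: per.
  move/windowP: eqd => eqd.
  have -> : k + d0 = t + d + (k + d0 - d - t) by lia.
  rewrite eqd; last by lia.
  have -> : t + (k + d0 - d - t) = k - d + d0 by lia.
  rewrite per; try lia.
  have -> : k - d = t + (k - d - t) by lia.
  by rewrite -eqd; [congr x|]; lia.
apply/x_aper/(eventually_period_eventually_periodic d0_gt0 (N := t0)) => k le_k.
by have [t [le_t _ per]] := run (k + d0); apply: per => //; lia.
Qed.

(** * Counting palindromic factors *)

Definition palindromes x n : {set n.-tuple A} :=
  [set u in factors x n | rev u == u :> seq A].

Lemma window_shift x L t u n j :
    window x L t = window x L u -> j + n <= L ->
  window x n (t + j) = window x n (u + j).
Proof.
move=> /windowP eq_tu le_L; apply/windowP=> k k_lt.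
by rewrite -!addnA eq_tu //; lia.
Qed.

Lemma palindromes_bound x n m :
    ~ eventually_periodic x -> reversal_closed x -> 4 * m <= n ->
  #|palindromes x n| * m.+1 <= 2 * rho x (n + m).
Proof.
move=> x_aper x_rev le_mn.
have /boolp.choice[pos posP] (w : n.-tuple A) : exists t,
    w \in factors x n -> [/\ m <= t, window x n t = w
      & forall d, 0 < d <= m -> window x n (t + d) <> w].
  have [/factorsP[s ->] | _] := boolP (w \in factors x n); last by exists 0.
  have [t [le_t Dt isol]] := isolated_occurrence s x_aper x_rev le_mn.
  by exists t => _; split=> // d d_m; rewrite -Dt; apply: isol.
pose D := setX (palindromes x n) [set: 'I_m.+1].
pose F (wj : n.-tuple A * 'I_m.+1) := window x (n + m) (pos wj.1 - wj.2).
(* All pairs of a fiber can thus be read off at one common position [t]. As [m <= pos w], the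
   subtraction in [F] is not truncated. *)
have at_offset wj t : wj \in D -> F wj = window x (n + m) t ->
    window x n (t + wj.2) = wj.1 /\ pal_at (fun k => x (t + k)) n wj.2.
  case: wj => w j; rewrite !inE andbT /= => /andP[w_fac /eqP w_pal] Dt.
  have [le_t Dw _] : [/\ m <= pos w, window x n (pos w) = w
      & forall d, 0 < d <= m -> window x n (pos w + d) <> w].
    by apply: posP; rewrite inE.
  have lt_j := ltn_ord j.
  have Dtj : window x n (t + j) = w.
    rewrite -(window_shift (j := j) Dt) /= ?subnK ?Dw //; lia.
  split=> // k k_lt; rewrite !addnA; apply: palindrome_window k k_lt.
  by rewrite Dtj.
(* Equal words would recur [wj.2 - wi.2 <= m] after the chosen isolated occurrence. *)
have isolated wi wj : wi \in D -> wj \in D -> F wi = F wj ->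
    wi.2 < wj.2 -> wi.1 <> wj.1.
  move=> Di Dj eqF lt_ij eq_w.
  have [w_j _] := at_offset wj (pos wi.1 - wi.2) Dj (esym eqF).
  have := Di; rewrite !inE => /andP[/andP[w_fac _] _].
  have [|le_t Dw isol] := posP wi.1; first by rewrite inE.
  have lt_j := ltn_ord wj.2.
  apply: (isol (wj.2 - wi.2)); first by lia.
  by rewrite [RHS]eq_w -w_j; congr (window x n _); lia.
have no_three wi wj wk : wi \in D -> wj \in D -> wk \in D ->
    F wi = F wj -> F wj = F wk -> wi.2 < wj.2 -> wj.2 < wk.2 -> False.
  move=> Di Dj Dk Eij Ejk lt_ij lt_jk.
  set t := pos wi.1 - wi.2.
  have [wi_t pal_i] := at_offset wi t Di erefl.
  have [wj_t pal_j] := at_offset wj t Dj (esym Eij).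
  have [wk_t pal_k] := at_offset wk t Dk (esym (etrans Eij Ejk)).
  have lt_k := ltn_ord wk.2.
  have block u v : same_block (fun k => x (t + k)) n u v ->
      window x n (t + u) = window x n (t + v).
    by move=> eq_uv; apply/windowP => k k_lt; rewrite -!addnA eq_uv.
  have lt_ik := ltn_trans lt_ij lt_jk; have Eik := etrans Eij Ejk.
  have [|/block|/block|/block] :=
    three_palindromes lt_ij lt_jk _ pal_i pal_j pal_k.
  - lia.
  - by rewrite wi_t wj_t; apply: isolated.
  - by rewrite wi_t wk_t; apply: isolated.
  - by rewrite wj_t wk_t; apply: isolated.
have fiber z : #|[set wj in D | F wj == z]| <= 2.
  rewrite leqNgt; apply/negP=> /card_gt2P[w1 [w2 [w3 [[]]]]].
  move=> /setIdP[D1 /eqP F1] /setIdP[D2 /eqP F2] /setIdP[D3 /eqP F3].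
  case=> n12 n23 n31.
  (* Within a fiber the offset determines the word. It then remains to sort three distinct
     offsets. *)
  have neq wi wj : wi \in D -> wj \in D -> F wi = z -> F wj = z -> wi != wj ->
      wi.2 <> wj.2 :> nat.
    move=> Di Dj Fi Fj /eqP neq_w eq_o; apply: neq_w.
    have eqF : F wi = F wj by rewrite Fi.
    have [wi_t _] := at_offset wi _ Di erefl.
    have [wj_t _] := at_offset wj (pos wi.1 - wi.2) Dj (esym eqF).
    case: wi wj eq_o wi_t wj_t {Di Dj Fi Fj eqF} => [w j] [w' j'] /= eq_o.
    by rewrite -eq_o => -> ->; congr pair; apply: val_inj.
  have three wi wj wk : wi \in D -> wj \in D -> wk \in D ->
      F wi = z -> F wj = z -> F wk = z -> wi.2 < wj.2 -> wj.2 < wk.2 -> False.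
    by move=> Di Dj Dk Fi Fj Fk; apply: no_three; rewrite ?Fi ?Fj ?Fk.
  have [l12|l21|e12] := ltngtP w1.2 w2.2;
    last by case: (neq _ _ D1 D2 F1 F2 n12 e12).
    have [l23|l32|e23] := ltngtP w2.2 w3.2;
      last by case: (neq _ _ D2 D3 F2 F3 n23 e23).
      exact: (three w1 w2 w3).
    have [l13|l31|e13] := ltngtP w1.2 w3.2;
      last by case: (neq _ _ D3 D1 F3 F1 n31 (esym e13)).
      exact: (three w1 w3 w2).
    exact: (three w3 w1 w2).
  have [l13|l31|e13] := ltngtP w1.2 w3.2;
    last by case: (neq _ _ D3 D1 F3 F1 n31 (esym e13)).
    exact: (three w2 w1 w3).
  have [l23|l32|e23] := ltngtP w2.2 w3.2;
    last by case: (neq _ _ D2 D3 F2 F3 n23 e23).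
    exact: (three w2 w3 w1).
  exact: (three w3 w2 w1).
have -> : #|palindromes x n| * m.+1 = #|D| by rewrite cardsX cardsT card_ord.
rewrite -sum1_card (partition_big F [in factors x (n + m)]) => [|wj _];
  last exact: window_factor.
rewrite mulnC -sum_nat_const; apply: leq_sum => z _.
by rewrite sum1_card; apply: leq_trans (fiber z); rewrite cardsE.
Qed.

(** * Reversal classes and the final estimate *)

Lemma rev_equiv_equivalence n : equivalence_rel (@rev_equiv A n).
Proof.
move=> u v w; rewrite /rev_equiv !inE eqxx; split=> //.
have revK_u : [tuple of rev [tuple of rev u]] = u.
  by apply: val_inj; apply: revK.
by case/orP=> /eqP-> //; rewrite revK_u orbC.
Qed.

(** Each class has one or two elements; counting 2 per class overshoots by 1 exactly at the
    singletons, which inject into the palindromes. *)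
Lemma refl_complexity_bounds x n : reversal_closed x ->
  rho x n <= 2 * refl_complexity x n <= rho x n + #|palindromes x n|.
Proof.
move=> x_rev; set P := equivalence_partition (@rev_equiv A n) (factors x n).
have eqvR : {in factors x n & &, equivalence_rel (@rev_equiv A n)}.
  by move=> u v w _ _ _; apply: rev_equiv_equivalence.
have partP : partition P (factors x n) by apply: equivalence_partitionP.
have classE B : B \in P ->
    exists2 u, u \in factors x n & B = [set u; [tuple of rev u]].
  case/imsetP=> u u_fac ->; exists u => //; apply/setP=> v.
  rewrite in_set in_set2 /rev_equiv mem_seq2; apply: andb_idl.
  case/orP=> /eqP-> //; move: u_fac; rewrite !inE => /boolp.asboolP /x_rev ?.
  exact/boolp.asboolP.
rewrite /rho /refl_complexity -/P (card_partition partP) mulnC -sum_nat_const.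
apply/andP; split.
  apply: leq_sum => B /classE[u _ ->].
  by rewrite cards2; case: (_ != _).
have singleP : #|[set B in P | #|B| == 1]| <= #|palindromes x n|.
  rewrite -(card_imset (mem (palindromes x n)) set1_inj).
  apply/subset_leq_card/subsetP=> B.
  rewrite inE => /andP[/classE[u u_fac ->]]; rewrite cards2.
  have [/= Du _ | //] := eqVneq u [tuple of rev u].
  rewrite -Du setUid imset_f // in_set u_fac.
  exact/eqP/(congr1 val (esym Du)).
apply: leq_trans (leq_add (leqnn _) singleP).
rewrite -sum1dep_card big_mkcondr -big_split.
apply: leq_sum => B /classE[u _ ->].
by rewrite cards2; case: (_ != _).
Qed.

End Words.

Local Open Scope ring_scope.

Theorem theorem3p15 (A : finType) (x : nat -> A) (n : nat)
    (x_aperiodic : ~ eventually_periodic x) (x_rev : reversal_closed x)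
    (n_ge1 : (1 <= n)%N) :
  1 / 2 * (rho x n)%:R <= (refl_complexity x n)%:R :> rat /\
  (refl_complexity x n)%:R <
    1 / 2 * (rho x n)%:R + 8 / n%:R * (rho x (n + n %/ 4))%:R :> rat.
Proof.
have /andP[lo up] := refl_complexity_bounds n x_rev.
have le_n : (4 * (n %/ 4) <= n)%N by lia.
have pal_le := palindromes_bound x_aperiodic x_rev le_n.
have rho_gt0 : (0 < rho x (n + n %/ 4))%N.
  by apply/card_gt0P; exists (window x _ 0); apply: window_factor.
(* With [m = n %/ 4], [n < 4 * m.+1] bounds [n] times the number of palindromes by
   [8 * rho x (n + m)], strictly below [16 * rho x (n + m)] by positivity. *)
have up_n : (2 * refl_complexity x n * n
    < rho x n * n + 16 * rho x (n + n %/ 4))%N by nia.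
have n_gt0 : 0 < n%:R :> rat by rewrite ltr0n.
split.
  have : (rho x n)%:R <= 2 * (refl_complexity x n)%:R :> rat.
    by rewrite -natrM ler_nat.
  lra.
rewrite -(ltr_pM2r n_gt0) mulrDl mulrAC [_ * n%:R in ltRHS]mulrAC.
rewrite [8 / _ * _ * _]mulrAC divfK ?gt_eqF //.
have : 2 * (refl_complexity x n)%:R * n%:R
    < (rho x n)%:R * n%:R + 16 * (rho x (n + n %/ 4))%:R :> rat.
  by rewrite -!natrM -natrD ltr_nat.
lra.
Qed.
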